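(* Let $\mathbb K$ be an algebraically closed field of characteristic $0$ and let $\mathcal A=\mathbb K[x_1,\dots,x_n]$ be graded so that each $x_i$ is homogeneous of positive degree. Let $R$ be the subalgebra of $\mathcal A$ generated by homogeneous elements $f_1,\dots,f_s$, and assume that the Jacobian locus $\mathcal J(f_1,\dots,f_s)$ has codimension $\ge 2$ in $\mathbb A^n$. Then $R$ is algebraically closed in $\mathcal A$: if $\tilde f\in\mathcal A$ is algebraic over $R$, then $\tilde f\in R$.
   Context: For $g_1,\dots,g_m\in\mathcal A$, the Jacobian locus $\mathcal J(g_1,\dots,g_m)$ is the set of $\xi\in\mathbb A^n$ at which the differentials $d_\xi g_1,\dots,d_\xi g_m$ are linearly dependent; it is Zariski closed. *)

(* Defs.v *)
From HB Require Import structures.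
From mathcomp Require Import all_boot all_order all_algebra.
From mathcomp.multinomials Require Import mpoly.
Set Implicit Arguments. Unset Strict Implicit. Unset Printing Implicit Defensive.
Import Order.TTheory GRing.Theory.
Local Open Scope ring_scope.

Section Defs.
Variables (K : fieldType) (n : nat).

Definition point := 'I_n -> K.

Definition wdeg (w : 'I_n -> nat) (m : 'X_{1..n}) : nat := (\sum_(i < n) w i * m i)%N.
Definition whomog (w : 'I_n -> nat) (p : {mpoly K[n]}) : Prop :=
  exists d : nat, forall m, m \in msupp p -> wdeg w m = d.

Definition in_subalg (s : nat) (f : 'I_s -> {mpoly K[n]}) (g : {mpoly K[n]}) : Prop :=
  exists P : {mpoly K[s]}, g = P \mPo [tuple f i | i < s].

Definition algebraic_over (s : nat) (f : 'I_s -> {mpoly K[n]}) (g : {mpoly K[n]}) : Prop :=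
  exists q : {poly {mpoly K[n]}},
    q != 0 /\ (forall i, in_subalg f q`_i) /\ q.[g] = 0.

Definition jacobian_locus (s : nat) (f : 'I_s -> {mpoly K[n]}) (xi : point) : Prop :=
  exists c : 'I_s -> K, (exists j, c j != 0) /\
    forall i : 'I_n, \sum_(j < s) c j * (mderiv i (f j)).@[xi] = 0.

Definition zclosed (Z : point -> Prop) : Prop :=
  exists S : {mpoly K[n]} -> Prop, forall x, Z x <-> (forall p, S p -> p.@[x] = 0).

Definition psubset (Z1 Z2 : point -> Prop) : Prop := forall x, Z1 x -> Z2 x.
Definition pstrict (Z1 Z2 : point -> Prop) : Prop :=
  psubset Z1 Z2 /\ exists x, Z2 x /\ ~ Z1 x.

Definition zirreducible (Z : point -> Prop) : Prop :=
  zclosed Z /\ (exists x, Z x) /\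
  forall Z1 Z2, zclosed Z1 -> zclosed Z2 ->
    psubset Z (fun x => Z1 x \/ Z2 x) -> psubset Z Z1 \/ psubset Z Z2.

(* Codimension of an irreducible closed W in A^n is at least k iff there is
   a chain W = W_0 < W_1 < ... < W_k of irreducible closed subsets. *)
Fixpoint chain_above (k : nat) (W : point -> Prop) : Prop :=
  match k with
  | 0%N => True
  | k'.+1 => exists W', zirreducible W' /\ pstrict W W' /\ chain_above k' W'
  end.

(* codim Z >= k (Z closed): every irreducible component of Z -- equivalently
   every irreducible closed subset of Z -- has codimension >= k.
   (The empty set has infinite codimension.) *)
Definition codim_ge (k : nat) (Z : point -> Prop) : Prop :=
  forall W, zirreducible W -> psubset W Z -> chain_above k W.

End Defs.

(* Main.v *)
(* Write dg for the gradient of g. If g is algebraic over R, differentiating an equation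
   q(g) = 0 with q'(g) <> 0 gives D dg = sum_j a_j df_j with D = q'(g).  A prime
   factor p of D divides every a_j: the irreducible hypersurface p = 0 has codimension 1, so it
   contains a point where the df_j are linearly independent, and Cramer's rule
   there gives mu a_j in (p) with p not dividing mu.  Hence dg = sum_j h_j df_j with h_j
   polynomial.  By symmetry of the Hessians each dh_j is again a combination of
   the df_j with rational coefficients.  For g homogeneous of degree e, h_j can be
   taken homogeneous of degree e - deg f_j < e, so h_j lies in R by induction, and
   Euler's formula e g = sum_j (deg f_j) h_j f_j concludes. *)
Require Import Defs.
From Stdlib Require Import Classical.
From HB Require Import structures.
From mathcomp Require Import all_boot all_order all_algebra.
From mathcomp.multinomials Require Import mpoly.
From mathcomp Require Import zify ring.
Set Implicit Arguments. Unset Strict Implicit. Unset Printing Implicit Defensive.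
Import GRing.Theory.
Local Open Scope ring_scope.

(** * Unique factorization and Gauss's lemma *)

Definition divides (R : comNzRingType) (a b : R) := exists c, b = a * c.

Definition prime_elt (R : comUnitRingType) (p : R) :=
  [/\ p != 0, p \isn't a GRing.unit &
      forall a b, divides p (a * b) -> divides p a \/ divides p b].

Inductive prime_factored (R : comUnitRingType) : R -> Prop :=
| PFunit u : u \is a GRing.unit -> prime_factored u
| PFprime p a : prime_elt p -> prime_factored a -> prime_factored (p * a).

(** Requiring prime rather than irreducible factors makes existence of a factorization suffice, as
    uniqueness then follows. *)
Definition is_ufd (R : comUnitRingType) :=
  forall a : R, a != 0 -> prime_factored a.

Section Divides.
Variable R : idomainType.
Implicit Types a b c p q : R.

Lemma divides_refl a : divides a a.
Proof. by exists 1; rewrite mulr1. Qed.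

Lemma divides_mulr a b c : divides a b -> divides a (b * c).
Proof. by move=> [x ->]; exists (x * c); rewrite mulrA. Qed.

Lemma divides_mull a b c : divides a b -> divides a (c * b).
Proof. by rewrite mulrC; apply: divides_mulr. Qed.

Lemma dividesD a b c : divides a b -> divides a c -> divides a (b + c).
Proof. by move=> [x ->] [y ->]; exists (x + y); rewrite mulrDr. Qed.

Lemma dividesDr a b c : divides a (b + c) -> divides a b -> divides a c.
Proof. by move=> [y e] [x ex]; exists (y - x); rewrite mulrBr -e -ex addrC addKr. Qed.

Lemma divides0 a : divides a 0.
Proof. by exists 0; rewrite mulr0. Qed.

Lemma prime_factoredM a b :
  prime_factored a -> prime_factored b -> prime_factored (a * b).
Proof.
move=> pa pb; elim: pa => [u uu|p c pp _ IH]; last first.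
  by rewrite -mulrA; apply: PFprime.
elim: pb => [v vu|p c pp _ IH]; first by apply: PFunit; rewrite unitrM uu.
by rewrite mulrCA; apply: PFprime.
Qed.

Lemma prime_dvd_prime p q : prime_elt p -> prime_elt q ->
  divides q p -> divides p q.
Proof.
move=> [p0 _ pp] [_ qu _] [t e].
have [//|[s es]] : divides p q \/ divides p t by apply: pp; rewrite -e; exact: divides_refl.
case/negP: qu; apply/unitrP; exists s.
have : p * 1 = p * (s * q) by rewrite mulr1 mulrA -es mulrC -e.
move/(mulfI p0) => <-; split=> //; rewrite mulrC.
by apply: (mulfI p0); rewrite mulr1 mulrA -es mulrC -e.
Qed.
End Divides.

Section Gauss.
Variable R : idomainType.
Implicit Types (c : R) (p q f g h : {poly R}).

Lemma divides_polyC c p : divides c%:P p <-> forall i, divides c p`_i.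
Proof.
split=> [[k ->] i|]; first by exists k`_i; rewrite coefCM.
elim/poly_ind: p => [|p a IH] H; first exact: divides0.
apply: dividesD; first (apply: divides_mulr; apply: IH => i).
  by have := H i.+1; rewrite coefD coefMX coefC /= addr0.
have := H 0%N; rewrite coefD coefMX coefC /= add0r => -[x ->].
by exists x%:P; rewrite polyCM.
Qed.

(** The quotient by [c] is a polynomial ring over a domain. The double induction strips constant
    terms: one divisible by [c] is dropped, and if that of the first factor is not, that of the
    second is. *)
Lemma prime_polyC c : prime_elt c -> prime_elt c%:P.
Proof.
move=> [c0 cu cp]; split; rewrite ?polyC_eq0 //.
  by rewrite poly_unitE coefC /= negb_and cu orbT.
elim/poly_ind => [|p a IHp] q; first by left; exact: divides0.
have dX g : divides c%:P (g * 'X) -> divides c%:P g.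
  move=> /divides_polyC H; apply/divides_polyC => i.
  by have := H i.+1; rewrite coefMX.
have dC x : divides c x -> divides c%:P x%:P.
  by move=> [y ->]; exists y%:P; rewrite polyCM.
have [ca|ca] := classic (divides c a).
  rewrite mulrDl addrC => /dividesDr H.
  have /IHp [|] : divides c%:P (p * q).
    by apply: dX; rewrite mulrAC; apply: H; apply: divides_mulr; exact: dC.
  - by move=> H'; left; apply: dividesD; [exact: divides_mulr | exact: dC].
  by right.
elim/poly_ind: q => [|q b IHq]; first by right; exact: divides0.
move=> H.
have cb : divides c b.
  have /divides_polyC/(_ 0%N) := H.
  by rewrite coef0M !coefD !coefMX !coefC /= !add0r => /cp[].
have [|H'|H'] := IHq.
- apply: dX; move: H; rewrite mulrDr mulrA addrC.
  by move/dividesDr; apply; apply: divides_mull; exact: dC.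
- by left.
by right; apply: dividesD; [exact: divides_mulr | exact: dC].
Qed.

(** Content one, stated through prime constants so that no gcd of coefficients is needed. *)
Definition primitive f := forall c, prime_elt c -> ~ divides c%:P f.

Lemma prime_factored_polyC c : prime_factored c -> prime_factored c%:P.
Proof.
elim=> [u uu|p a pp _ IH]; last by rewrite polyCM; apply: PFprime => //; exact: prime_polyC.
by apply: PFunit; rewrite poly_unitE coefC uu size_polyC (memPn _ _ uu) // unitr0.
Qed.

(** Each prime factor of [c] divides the product of [f] and its cofactor but not [f], so it cancels
    from the cofactor. *)
Lemma primitive_cancel c f h : prime_factored c -> primitive f ->
  divides f (c%:P * h) -> divides f h.
Proof.
move=> pc prf; elim: pc h => [u uu|p a pp _ IH] h [k e].
  exists ((u^-1)%:P * k); rewrite mulrCA -e mulrA -polyCM mulVr //.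
  by rewrite mul1r.
have [_ _ /(_ f k)] := prime_polyC pp; rewrite -e polyCM -mulrA.
case; first by exists (a%:P * h).
  by move/prf => /(_ pp).
move=> [l el]; apply: IH; exists l.
have p0 : p%:P != 0 by rewrite polyC_eq0; case: pp.
by apply: (mulfI p0); rewrite mulrA -polyCM e el mulrCA.
Qed.

(** Gauss's lemma without fractions: each prime factor of [c] divides [d] or [e] and is cancelled
    there, which leaves the sizes unchanged. *)
Lemma split_scaled c f d e : prime_factored c -> f != 0 ->
  c%:P * f = d * e ->
  exists d' e', [/\ f = d' * e', size d' = size d & size e' = size e].
Proof.
move=> pc f0; elim: pc d e => [u uu|p a pp _ IH] d e E.
  have u0 : u^-1 != 0 by rewrite invr_eq0; apply: contraTneq uu => ->; rewrite unitr0.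
  exists (u^-1 *: d), e; split=> //; last by rewrite size_scale.
  by rewrite -scalerAl -E -mul_polyC mulrA -polyCM mulVr // mul1r.
have p0 : p != 0 by case: pp.
have pP0 : p%:P != 0 by rewrite polyC_eq0.
have [_ _ /(_ d e)] := prime_polyC pp; rewrite -E polyCM -mulrA.
case; first by exists (a%:P * f).
- move=> [k ek]; have [|d' [e' [ef sd se]]] := IH k e.
    by apply: (mulfI pP0); rewrite !mulrA -polyCM E ek.
  by exists d', e'; rewrite ek mul_polyC size_scale.
move=> [k ek]; have [|d' [e' [ef sd se]]] := IH d k.
  by apply: (mulfI pP0); rewrite !mulrA -polyCM E ek mulrCA mulrA.
by exists d', e'; rewrite ek mul_polyC size_scale.
Qed.

(* Induction on the prime factors of the leading coefficient [a * b]: those already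
   known not to divide [f] are collected in [b]. *)
Lemma content_split a f b : prime_factored a -> f != 0 ->
  lead_coef f = a * b ->
  (forall r, prime_elt r -> divides r b -> ~ divides r%:P f) ->
  exists c f0, [/\ f = c%:P * f0, prime_factored c & primitive f0].
Proof.
move=> pa; elim: pa f b => [u uu|p {}a pp _ IH] f b f0 lf H.
  exists 1, f; split; rewrite ?mul1r //; first exact/PFunit/unitr1.
  move=> c pc dcf; apply: (H c pc) => //.
  have /divides_polyC/(_ (size f).-1) [x e] := dcf.
  exists (u^-1 * x); rewrite mulrCA -e -lead_coefE lf mulrA mulVr //.
  by rewrite mul1r.
have pz : p != 0 by case: pp.
have [[k ek]|nd] := classic (divides p%:P f).
  have [|||c [f1 [e1 pc pf1]]] := IH k b.
  - by apply: contraNneq f0 => k0; rewrite ek k0 mulr0.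
  - apply: (mulfI pz); rewrite mulrA -lf ek lead_coefM lead_coefC //.
  - move=> r pq qb [l el]; apply: (H r pq qb); rewrite ek el mulrCA.
    apply: divides_mulr; exact: divides_refl.
  exists (p * c), f1; split=> //; last exact: PFprime.
  by rewrite ek e1 polyCM mulrA.
apply: (IH f (p * b)) => //; first by rewrite lf mulrCA mulrA.
move=> r pq; case: (pq) => _ _ /(_ p b) qpb /qpb [qp|]; last exact: H.
move=> [k ek]; apply: nd; rewrite ek.
have [l ->] := prime_dvd_prime pp pq qp.
by rewrite polyCM -mulrA; apply: divides_mulr; exact: divides_refl.
Qed.

Hypothesis UFD : is_ufd R.

(** Let [f] divide [g * h]. Coprimality with [g] gives a Bezout identity up to a constant, whence
    [f] divides [h]; otherwise irreducibility makes [f] proportional to the gcd, and [f] divides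
    [g]. Primitivity removes the constants. *)
Lemma primitive_irreducible_prime f : (1 < size f)%N -> primitive f ->
  (forall g h, f = g * h -> (size f <= size g)%N \/ (size f <= size h)%N) ->
  prime_elt f.
Proof.
move=> sf prf irr; have f0 : f != 0 by rewrite -size_poly_gt0 ltnW.
split=> // [|g h fgh]; first by rewrite poly_unitE negb_and gtn_eqF.
have [cop|ncop] := boolP (coprimep f g).
  right; have /Bezout_coprimepP [[u v] /eqpP [[c1 c2] /= /andP [c10 c20] E]] := cop.
  apply: (@primitive_cancel c2) => //; first exact: UFD.
  have -> : c2%:P * h = f * (c1 *: u * h) + g * h * (c1 *: v).
    move: E; rewrite -alg_polyC => <-.
    by rewrite -!mul_polyC; ring.
  by apply: dividesD; [exists (c1 *: u * h) | exact: divides_mulr].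
left; set d := gcdp f g.
have d0 : d != 0 by rewrite gcdp_eq0 negb_and f0.
have sd : (1 < size d)%N.
  by rewrite ltn_neqAle eq_sym size_poly_gt0 d0 andbT.
have /Pdiv.WeakIdomain.dvdpP [[c e] /= c0 Ef] := dvdp_gcdl f g.
have /Pdiv.WeakIdomain.dvdpP [[c' k] /= c'0 Eg] := dvdp_gcdr f g.
rewrite -/d -!mul_polyC in Ef Eg.
have e0 : e != 0.
  apply: contra_neq f0 => e0; move: Ef; rewrite e0 mul0r.
  by move/eqP; rewrite mulf_eq0 polyC_eq0 (negbTE c0) => /eqP.
have se : size e = 1%N.
  have := congr1 (size : {poly R} -> nat) Ef.
  rewrite mul_polyC size_scale // size_mul // => sE.
  have [e' [d' [Ef' se' sd']]] := split_scaled (UFD c0) f0 Ef.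
  have := irr _ _ Ef'; rewrite se' sd' sE; move: sd e0; rewrite -size_poly_gt0.
  move: (size d) (size e) => [|[|x]] [|[|y]] //= _ _.
  by rewrite !addSn !addnS /= => -[|]; lia.
have /size_poly1P [e1 e10 Ee] : size e == 1%N by rewrite se.
apply: (@primitive_cancel (e1 * c')) => //; first by apply: UFD; rewrite mulf_neq0.
exists (c%:P * k).
by rewrite polyCM -mulrA Eg -Ee mulrCA -Ef mulrCA [k * f]mulrC mulrCA.
Qed.

Theorem is_ufd_poly : is_ufd {poly R}.
Proof.
move=> f; move: {2}(size f).+1 (ltnSn (size f)) => N.
elim: N f => // N IH f sf f0.
have lf0 : lead_coef f != 0 by rewrite lead_coef_eq0.
have [|q [_ qu _] [x e]|c [f1 [ef pc prf]]] :=
  @content_split _ f 1 (UFD lf0) f0; first by rewrite mulr1.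
  by case/negP: qu; apply/unitrP; exists x; rewrite -e mulrC -e.
have c0 : c != 0 by apply: contraNneq f0 => c0; rewrite ef c0 mul0r.
have f10 : f1 != 0 by apply: contraNneq f0 => h; rewrite ef h mulr0.
have sff : size f = size f1 by rewrite ef mul_polyC size_scale.
rewrite ef; apply: prime_factoredM; first exact: prime_factored_polyC.
have [sf1|sf1] := leqP (size f1) 1.
  rewrite (size1_polyC sf1); apply/prime_factored_polyC/UFD.
  by apply: contraNneq f10 => h; rewrite (size1_polyC sf1) h.
have [[g [h [e sg sh]]]|irr] := classic (exists g h,
    [/\ f1 = g * h, (size g < size f1)%N & (size h < size f1)%N]).
  move: f10; rewrite {1}e mulf_eq0 negb_or => /andP[g0 h0].
  rewrite e; apply: prime_factoredM; apply: IH => //.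
    by rewrite sff in sf; apply: leq_trans sg sf.
  by rewrite sff in sf; apply: leq_trans sh sf.
rewrite -[f1]mulr1; apply: PFprime; last exact/PFunit/unitr1.
apply: primitive_irreducible_prime => // g h e.
have [|sg] := leqP (size f1) (size g); first by left.
have [|sh] := leqP (size f1) (size h); first by right.
by case: irr; exists g, h.
Qed.
End Gauss.

(** * Hypersurfaces in affine space *)

Section Transfer.
Variables (A B : idomainType) (phi : {rmorphism A -> B}) (psi : {rmorphism B -> A}).
Hypotheses (phiK : cancel phi psi) (psiK : cancel psi phi).

Lemma prime_elt_iso p : prime_elt p -> prime_elt (psi p).
Proof.
move=> [p0 pu pp]; split=> [||a b [c e]].
- by apply: contra_neq p0 => h; rewrite -[p]psiK h rmorph0.
- by apply: contra pu => h; rewrite -[p]psiK rmorph_unit.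
have [|[k ek]|[k ek]] := pp (phi a) (phi b).
- by exists (phi c); rewrite -rmorphM e rmorphM psiK.
- by left; exists (psi k); rewrite -rmorphM -ek phiK.
by right; exists (psi k); rewrite -rmorphM -ek phiK.
Qed.

Lemma is_ufd_iso : is_ufd B -> is_ufd A.
Proof.
move=> fB a a0; rewrite -[a]phiK.
have : phi a != 0 by apply: contra_neq a0 => h; rewrite -[a]phiK h rmorph0.
move/fB; elim=> [u uu|p b pp _ IH]; first by apply/PFunit/rmorph_unit.
by rewrite rmorphM; apply: PFprime => //; exact: prime_elt_iso.
Qed.
End Transfer.

Lemma widen_ord_max (n : nat) (i : 'I_n) :
  widen_ord (leqnSn n) i = lift ord_max i.
Proof. by apply: val_inj; rewrite /= /bump leqNgt ltn_ord. Qed.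

(** * Polynomials in [n.+1] variables as univariate polynomials over those in [n] *)

Section Univariate.
Variables (R : idomainType) (n : nat).

(** Inverse of [muni]: the univariate variable becomes the last of the [n.+1] variables. *)
Definition mmult (q : {poly {mpoly R[n]}}) : {mpoly R[n.+1]} :=
  (map_poly (@mwiden n R) q).['X_ord_max].

HB.instance Definition _ := GRing.RMorphism.copy mmult
  (horner_eval 'X_ord_max \o map_poly (@mwiden n R)).

Lemma mmultD : {morph mmult : p q / p + q}.
Proof. exact: rmorphD. Qed.

Lemma mmultM : {morph mmult : p q / p * q}.
Proof. exact: rmorphM. Qed.

Lemma mmultXn k : {morph mmult : p / p ^+ k}.
Proof. exact: rmorphXn. Qed.

Lemma mmultC a : mmult a%:P = mwiden a.
Proof. by rewrite /mmult map_polyC hornerC. Qed.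

Lemma mmultX : mmult 'X = 'X_ord_max.
Proof. by rewrite /mmult map_polyX hornerX. Qed.

Lemma muni_monomial m : muni ('X_[m] : {mpoly R[n.+1]}) =
  'X_[[multinom m (widen_ord (leqnSn n) i) | i < n]] *: 'X^(m ord_max).
Proof. by rewrite muniE msuppX big_seq1 mcoeffX eqxx scale1r. Qed.

Lemma muniK : cancel (@muni n R) mmult.
Proof.
elim/mpolyind => [|c m p _ _ IH]; first by rewrite muni0 rmorph0.
rewrite muniD mmultD; congr (_ + _); last exact: IH.
rewrite muniZ muni_monomial -mul_polyC mmultM -mul_polyC mmultM mmultXn.
rewrite !mmultC mmultX mwidenC mwidenX mul_mpolyC; congr (_ *: _).
rewrite mpolyXn -mpolyXD; congr 'X_[_]; apply/mnmP => i.
rewrite mnmDE mulmnE mnm1E; case: (unliftP ord_max i) => [j|] ->.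
  rewrite (negbTE (neq_lift _ _)) addn0.
  by rewrite -widen_ord_max mnmwiden_widen mnmE.
by rewrite mnmwiden_ordmax eqxx mul1n.
Qed.

Lemma mmultK : cancel mmult (@muni n R).
Proof.
elim/poly_ind => [|q a IH]; first by rewrite !rmorph0.
rewrite mmultD mmultM mmultX mmultC muniD muniM IH; congr (_ * _ + _).
  rewrite muni_monomial mnm1E eqxx.
  suff -> : [multinom U_(ord_max)%MM (widen_ord (leqnSn n) i) | i < n] = 0%MM.
    by rewrite mpolyX0 scale1r.
  apply/mnmP => i; rewrite !mnmE.
  by case: eqP => // /(congr1 val) /=; have := ltn_ord i; lia.
elim/mpolyind: a => [|c m a _ _ {}IH]; first by rewrite mwiden0 muni0.
rewrite mwidenD muniD IH polyCD; congr (_ + _); rewrite mwidenZ mwidenX muniZ muni_monomial.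
rewrite mnmwiden_ordmax expr0 alg_polyC -mul_mpolyC polyCM mul_polyC.
congr (_ *: 'X_[_]%:P); apply/mnmP => i.
by rewrite mnmE mnmwiden_widen.
Qed.
End Univariate.

Lemma mpoly0_const (R : nzRingType) (p : {mpoly R[0]}) : p = (p@_0%MM)%:MP.
Proof.
apply/mpolyP => m; have -> : m = 0%MM by apply/mnmP => -[].
by rewrite mcoeffC eqxx mulr1.
Qed.

Theorem is_ufd_mpoly (K : fieldType) (n : nat) : is_ufd {mpoly K[n]}.
Proof.
elim: n => [|n IH]; last first.
  by apply: (is_ufd_iso (@muniK K n) (@mmultK K n)); apply: is_ufd_poly.
move=> p p0; apply: PFunit; rewrite (mpoly0_const p) in p0 *.
rewrite rmorph_unit // unitfE.
by apply: contra_neq p0 => ->; rewrite mpolyC0.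
Qed.

(** For nonconstant [q], a root of [q - 1] serves. *)
Lemma poly_nonroot (K : closedFieldType) (q : {poly K}) :
  q != 0 -> exists t, q.[t] != 0.
Proof.
move=> q0; have [sq|sq] := leqP (size q) 1.
  exists 0; rewrite (size1_polyC sq) hornerC.
  by apply: contra_neq q0 => h; rewrite (size1_polyC sq) h.
have /closed_rootP [t] : size (q - 1) != 1%N.
  by rewrite size_polyDl ?size_polyN ?size_poly1 // gtn_eqF.
by rewrite rootE !hornerE subr_eq0 => /eqP e; exists t; rewrite e oner_eq0.
Qed.

Section Eval.
Variables (K : fieldType) (n : nat).

Definition extend (x : 'I_n -> K) (t : K) (i : 'I_n.+1) : K :=
  if unlift ord_max i is Some j then x j else t.

Lemma meval_mwiden x t (a : {mpoly K[n]}) : (mwiden a).@[extend x t] = a.@[x].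
Proof.
elim/mpolyind: a => [|c m a _ _ IH]; first by rewrite mwiden0 !meval0.
rewrite mwidenD !mevalD IH mwidenZ mwidenX !mevalZ !mevalX.
congr (_ * _ + _).
rewrite big_ord_recr /= mnmwiden_ordmax expr0 mulr1.
apply: eq_bigr => i _; rewrite mnmwiden_widen /extend.
by rewrite widen_ord_max liftK.
Qed.

Lemma meval_extend x t (p : {mpoly K[n.+1]}) :
  p.@[extend x t] = (map_poly (meval x) (muni p)).[t].
Proof.
rewrite -{1}[p]muniK; elim/poly_ind: (muni p) => [|q a IH].
  by rewrite !rmorph0 horner0.
rewrite mmultD mmultM mmultX mmultC !mevalD !mevalM IH /=.
rewrite rmorphD rmorphM /= map_polyX map_polyC !hornerE.
by rewrite meval_mwiden mevalXU /extend unlift_none.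
Qed.
End Eval.

Lemma mpoly_nonvanishing (K : closedFieldType) (n : nat) (p : {mpoly K[n]}) :
  p != 0 -> exists x, p.@[x] != 0.
Proof.
elim: n p => [|n IH] p p0.
  exists (fun _ => 0); rewrite (mpoly0_const p) mevalC.
  by apply: contra_neq p0 => h; rewrite (mpoly0_const p) h.
have q0 : muni p != 0 by apply: contra_neq p0 => h; rewrite -[p]muniK h rmorph0.
have [x px] := IH (lead_coef (muni p)) ltac:(by rewrite lead_coef_eq0).
have [|t pt] := @poly_nonroot _ (map_poly (meval x) (muni p)).
  by apply: contra_neq px => h; rewrite lead_coefE -(coef_map (meval x)) h coef0.
by exists (extend x t); rewrite meval_extend.
Qed.

(** If the gcd [d] is nonconstant, write [c%:P * f = e * d]. Degrees forbid [f] to divide [e], so it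
    divides [d], hence [c'%:P * g], hence [g], as [c'] is a nonzero constant. *)
Lemma prime_coprimep (R : idomainType) (f g : {poly R}) :
  prime_elt f -> (1 < size f)%N -> ~ divides f g -> coprimep f g.
Proof.
move=> [f0 fu fp] sf ndiv; apply: NNPP => /negP ncop.
set d := gcdp f g.
have d0 : d != 0 by rewrite gcdp_eq0 negb_and f0.
have sd : (1 < size d)%N.
  by rewrite ltn_neqAle eq_sym size_poly_gt0 d0 andbT.
have /Pdiv.WeakIdomain.dvdpP [[c e] /= c0 Ef] := dvdp_gcdl f g.
have /Pdiv.WeakIdomain.dvdpP [[c' k] /= c'0 Eg] := dvdp_gcdr f g.
rewrite -/d -!mul_polyC in Ef Eg.
have e0 : e != 0.
  apply: contra_neq f0 => e0; move: Ef; rewrite e0 mul0r.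
  by move/eqP; rewrite mulf_eq0 polyC_eq0 (negbTE c0) => /eqP.
have [|[l el]|[l el]] := fp e d.
- by exists c%:P; rewrite -Ef mulrC.
- have l0 : l != 0 by apply: contra_neq e0 => h; rewrite el h mulr0.
  have := congr1 (size : {poly R} -> nat) Ef.
  rewrite mul_polyC size_scale // size_mul // el size_mul //.
  by move: sd l0; rewrite -(size_poly_gt0 l); lia.
have [|[j ej]|//] := fp c'%:P g.
- by exists (k * l); rewrite Eg el mulrCA.
have j0 : j != 0.
  by apply: contra_neq c'0 => h; apply/eqP; rewrite -polyC_eq0 ej h mulr0.
have := congr1 (size : {poly R} -> nat) ej.
rewrite size_polyC c'0 size_mul //.
by move: sf j0; rewrite -(size_poly_gt0 j); lia.
Qed.

(** At a point [x] where neither the Bezout constant nor the leading coefficient of [p] vanishes,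
    [p] keeps its degree and has a root; the Bezout identity prevents [q] from vanishing there. *)
Lemma coprimep_eval (K : closedFieldType) (n : nat) (p q : {poly {mpoly K[n]}}) :
  (1 < size p)%N -> coprimep p q -> exists x t,
    (map_poly (meval x) p).[t] = 0 /\ (map_poly (meval x) q).[t] != 0.
Proof.
move=> sp /Bezout_coprimepP [[u v] /eqpP [[c1 c2] /= /andP [c10 c20] E]].
have lp0 : lead_coef p != 0 by rewrite lead_coef_eq0 -size_poly_gt0 ltnW.
have [x] := mpoly_nonvanishing (mulf_neq0 c20 lp0).
rewrite mevalM mulf_eq0 negb_or => /andP[c2x lx].
have /closed_rootP [t /rootP rt] : size (map_poly (meval x) p) != 1%N.
  by rewrite size_map_poly_id0 ?gtn_eqF.
exists x, t; split=> //; apply: contra_neq c2x => qt.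
have {}E : c1%:P * (u * p + v * q) = c2%:P by rewrite mul_polyC E alg_polyC.
move/(congr1 (fun r => (map_poly (meval x) r).[t])): E.
rewrite !rmorphM rmorphD !rmorphM /= !hornerE rt qt !mulr0 addr0 mulr0.
by rewrite map_polyC hornerC => <-.
Qed.

(** Induction on [n], singling out the last variable. If [p] does not involve it, induction applies
    to each coefficient of [q]; otherwise, were [p] not to divide [q], they would be coprime and
    some zero of [p] would not be one of [q]. *)
Theorem hypersurface_nullstellensatz (K : closedFieldType) (n : nat)
    (p q : {mpoly K[n]}) :
  prime_elt p -> (forall x, p.@[x] = 0 -> q.@[x] = 0) -> divides p q.
Proof.
elim: n p q => [|n IH] p q pp van.
  have [p0 /negP pu _] := pp; case: pu; rewrite (mpoly0_const p) in p0 *.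
  rewrite rmorph_unit // unitfE.
  by apply: contra_neq p0 => ->; rewrite mpolyC0.
have pP : prime_elt (muni p) := prime_elt_iso (@mmultK K n) (@muniK K n) pp.
suff [k ek] : divides (muni p) (muni q).
  by exists (mmult k); rewrite -[q]muniK ek mmultM muniK.
have [sp|sp] := leqP (size (muni p)) 1.
  have [c Ec] : exists c, muni p = c%:P by exists (muni p)`_0; exact: size1_polyC.
  rewrite Ec in pP *; apply/divides_polyC => i.
  have pc : prime_elt c.
    case: pP => c0 cu cp; split=> [||a b [k ek]].
    - by apply: contra_neq c0 => ->; rewrite polyC0.
    - by apply: contra cu => h; rewrite rmorph_unit.
    have [|/divides_polyC/(_ 0%N)|/divides_polyC/(_ 0%N)] := cp a%:P b%:P.
    + by exists k%:P; rewrite -!polyCM ek.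
    + by rewrite coefC; left.
    by rewrite coefC; right.
  apply: IH => // x cx; rewrite -coef_map.
  suff -> : map_poly (meval x) (muni q) = 0 by rewrite coef0.
  apply/eqP; apply: contraT => /poly_nonroot [t]; rewrite -meval_extend van ?eqxx //.
  by rewrite meval_extend Ec map_polyC hornerC /= cx.
apply: NNPP => /(prime_coprimep pP sp)/(coprimep_eval sp) [x [t [pxt]]].
by rewrite -meval_extend van ?eqxx // meval_extend.
Qed.

(** * Irreducible closed sets and codimension *)

Section Codim.
Variables (K : closedFieldType) (n : nat).
Implicit Types (p q : {mpoly K[n]}) (Z W : point K n -> Prop).

Definition zeros p : point K n -> Prop := fun x => p.@[x] = 0.

Lemma zeros_closed p : zclosed (zeros p).
Proof. by exists (eq p) => x; split=> [h q <- //|h]; exact: h. Qed.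

Lemma not_psubset_closed Z W : zclosed Z -> ~ psubset W Z ->
  exists2 p, psubset Z (zeros p) & exists2 x, W x & p.@[x] != 0.
Proof.
move=> [S SZ] nWZ; apply: NNPP => H; apply: nWZ => x Wx; apply/SZ => p Sp.
apply/eqP; apply: contraT => px; case: H; exists p; last by exists x.
by move=> y /SZ; apply.
Qed.

(** Hypersurfaces suffice as tests: if neither closed set contains [W], each has an equation failing
    somewhere on [W], and the product of the two vanishes on the union. *)
Lemma zirreducibleP W : zclosed W -> (exists x, W x) ->
  (forall p q, psubset W (zeros (p * q)) ->
     psubset W (zeros p) \/ psubset W (zeros q)) -> zirreducible W.
Proof.
move=> cW nW H; split=> //; split=> // Z1 Z2 c1 c2 sub.
apply: NNPP => /not_or_and [n1 n2].
have [p Zp [x Wx px]] := not_psubset_closed c1 n1.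
have [q Zq [y Wy qy]] := not_psubset_closed c2 n2.
case: (H p q) => [z Wz|h|h].
- by rewrite /zeros mevalM; case: (sub z Wz) => [/Zp|/Zq] ->; rewrite ?mul0r ?mulr0.
- by rewrite h ?eqxx in px.
by rewrite h ?eqxx in qy.
Qed.

Lemma zeros_prime_irreducible p : prime_elt p -> zirreducible (zeros p).
Proof.
move=> pp; apply: zirreducibleP; first exact: zeros_closed.
  (* An empty zero set would make [p] divide 1. *)
  apply: NNPP => H; have [_ /negP pu _] := pp; case: pu.
  have [|c e] := @hypersurface_nullstellensatz _ _ p 1 pp.
    by move=> x px; case: H; exists x.
  by apply/unitrP; exists c; rewrite mulrC -e.
move=> q r /(hypersurface_nullstellensatz pp).
case: (pp) => _ _ H /H [[k ->]|[k ->]]; [left|right] => x;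
  by rewrite /zeros mevalM => ->; rewrite mul0r.
Qed.

Lemma irreducible_in_prime_zeros W q : zirreducible W -> q != 0 ->
  psubset W (zeros q) -> exists2 p, prime_elt p & psubset W (zeros p).
Proof.
move=> [_ [[x Wx] irr]] /is_ufd_mpoly.
elim=> [u uu /(_ x Wx)|p a pp _ IH sub].
  have := congr1 (meval x) (mulrV uu); rewrite mevalM meval1 => e h.
  by move: e; rewrite h mul0r => /eqP; rewrite eq_sym oner_eq0.
have [y Wy|h|/IH//] := irr _ _ (zeros_closed p) (zeros_closed a); last by exists p.
have /eqP := sub y Wy; rewrite mevalM mulf_eq0 => /orP[] /eqP; by [left|right].
Qed.

(** A strictly larger irreducible [W], itself proper, would lie in some [zeros r] with [r] prime.
    Then [p] divides [r], so [r] divides [p], and [W] falls back into [zeros p]. *)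
Lemma codim_zeros_prime p : prime_elt p -> ~ chain_above 2 (zeros p).
Proof.
move=> pp [W [iW [[sW [x [Wx npx]]] [W' [_ [[_ [y [_ nWy]]] _]]]]]].
have [|q Wq [z _ qz]] := @not_psubset_closed W (fun=> True) (proj1 iW).
  by move=> /(_ y I).
have q0 : q != 0 by apply: contraNneq qz => ->; rewrite meval0.
have [r pr Wr] := irreducible_in_prime_zeros iW q0 Wq.
have [|k] := prime_dvd_prime pr pp; last first.
  by move=> e; apply: npx; rewrite /zeros e mevalM (Wr x Wx) mul0r.
by apply: hypersurface_nullstellensatz => // u /sW /Wr.
Qed.

Lemma whole_irreducible : zirreducible (fun _ : point K n => True).
Proof.
apply: zirreducibleP.
- by exists (fun _ => False).
- by exists (fun _ => 0).
move=> p q H; apply: NNPP => /not_or_and [np nq].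
have nz r : ~ psubset (fun _ => True) (zeros r) -> r != 0.
  by move=> h; apply/eqP => r0; apply: h => x _; rewrite /zeros r0 meval0.
have [x] := mpoly_nonvanishing (mulf_neq0 (nz _ np) (nz _ nq)).
by rewrite H ?eqxx.
Qed.

(** Otherwise the whole space, irreducible and with nothing strictly above it, would lie in [Z]. *)
Lemma codim2_nonempty_complement Z : codim_ge 2 Z -> exists x, ~ Z x.
Proof.
move=> cZ; apply: NNPP => H.
have [|W [_ [[_ [x [_ nx]]] _]]] := cZ _ whole_irreducible.
  by move=> x _; apply: NNPP => h; case: H; exists x.
exact: nx.
Qed.

Lemma codim2_prime Z p : codim_ge 2 Z -> prime_elt p ->
  exists2 x, p.@[x] = 0 & ~ Z x.
Proof.
move=> cZ pp; apply: NNPP => H.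
apply: (codim_zeros_prime pp); apply: cZ; first exact: zeros_prime_irreducible.
by move=> x px; apply: NNPP => h; apply: H; exists x.
Qed.
End Codim.

(** * Gradients and the Jacobian matrix *)

Section Subalgebra.
Variables (K : fieldType) (n s : nat) (f : 'I_s -> {mpoly K[n]}).
Implicit Types (g h : {mpoly K[n]}).

Lemma in_subalgC c : in_subalg f c%:MP.
Proof. by exists c%:MP; rewrite comp_mpolyC. Qed.

Lemma in_subalg0 : in_subalg f 0.
Proof. by rewrite -mpolyC0; exact: in_subalgC. Qed.

Lemma in_subalgD g h : in_subalg f g -> in_subalg f h -> in_subalg f (g + h).
Proof. by move=> [P ->] [Q ->]; exists (P + Q); rewrite comp_mpolyD. Qed.

Lemma in_subalgM g h : in_subalg f g -> in_subalg f h -> in_subalg f (g * h).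
Proof. by move=> [P ->] [Q ->]; exists (P * Q); rewrite rmorphM. Qed.

Lemma in_subalgZ c g : in_subalg f g -> in_subalg f (c *: g).
Proof. by move=> [P ->]; exists (c *: P); rewrite comp_mpolyZ. Qed.

Lemma in_subalgMn g k : in_subalg f g -> in_subalg f (g *+ k).
Proof. by move=> [P ->]; exists (P *+ k); rewrite comp_mpolyMn. Qed.

Lemma in_subalg_gen j : in_subalg f (f j).
Proof. by exists 'X_j; rewrite comp_mpolyXU -tnth_nth tnth_mktuple. Qed.

Lemma in_subalg_sum (I : Type) (r : seq I) (P : pred I) (F : I -> {mpoly K[n]}) :
  (forall i, P i -> in_subalg f (F i)) -> in_subalg f (\sum_(i <- r | P i) F i).
Proof.
by move=> H; elim/big_ind: _ => //; [exact: in_subalg0 | exact: in_subalgD].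
Qed.

Lemma in_subalg_ind (P : {mpoly K[n]} -> Prop) :
  (forall c, P c%:MP) -> (forall j, P (f j)) ->
  (forall g h, P g -> P h -> P (g + h)) ->
  (forall g h, P g -> P h -> P (g * h)) ->
  forall g, in_subalg f g -> P g.
Proof.
move=> HC Hf HD HM g [Q ->]; elim/mpolyind: Q => [|c m Q _ _ IH].
  by rewrite comp_mpoly0 -mpolyC0.
rewrite comp_mpolyD; apply: HD => //.
rewrite comp_mpolyZ -mul_mpolyC; apply: (HM) => //.
rewrite comp_mpolyX; elim/big_ind: _ => [||j _]; [exact: (HC 1) | exact: (HM) |].
rewrite tnth_mktuple; elim: (m j) => [|k IHk]; first exact: (HC 1).
by rewrite exprS; apply: HM.
Qed.
End Subalgebra.

Section Jacobian.
Variables (K : fieldType) (n s : nat) (f : 'I_s -> {mpoly K[n]}).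
Implicit Types (g h : {mpoly K[n]}).

Definition grad g : 'rV[{mpoly K[n]}]_n := \row_i mderiv i g.
Definition jacobian : 'M[{mpoly K[n]}]_(s, n) := \matrix_(j, i) mderiv i (f j).

(** Linear dependence on the gradients of the [f j] over the fraction field, with common denominator
    [D]. *)
Definition rationally_dependent g := exists (D : {mpoly K[n]}) (a : 'rV_s),
  D != 0 /\ D *: grad g = a *m jacobian.

Lemma gradD g h : grad (g + h) = grad g + grad h.
Proof. by apply/rowP => i; rewrite !mxE mderivD. Qed.

Lemma gradM g h : grad (g * h) = h *: grad g + g *: grad h.
Proof. by apply/rowP => i; rewrite !mxE mderivM [h * _]mulrC. Qed.

Lemma row_jacobian j : row j jacobian = grad (f j).
Proof. by apply/rowP => i; rewrite !mxE. Qed.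

Lemma grad_in_subalg g : in_subalg f g -> exists a : 'rV_s, grad g = a *m jacobian.
Proof.
move: g; apply: in_subalg_ind => [c|j|g h [a ea] [b eb]|g h [a ea] [b eb]].
- by exists 0; rewrite mul0mx; apply/rowP => i; rewrite !mxE mderivC.
- by exists (delta_mx 0 j); rewrite -rowE row_jacobian.
- by exists (a + b); rewrite gradD ea eb mulmxDl.
by exists (h *: a + g *: b); rewrite gradM ea eb mulmxDl !scalemxAl.
Qed.

(** Chain rule: [a] collects the contributions of the coefficients of [q]. *)
Lemma grad_horner g (q : {poly {mpoly K[n]}}) : (forall i, in_subalg f q`_i) ->
  exists a : 'rV_s, grad q.[g] = a *m jacobian + q^`().[g] *: grad g.
Proof.
elim/poly_ind: q => [|q c IH] H.
  exists 0; rewrite mul0mx deriv0 !horner0 scale0r addr0.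
  by apply/rowP => i; rewrite !mxE mderiv0.
have [i|a ea] := IH.
  by have := H i.+1; rewrite coefD coefMX coefC /= addr0.
have [|b eb] := grad_in_subalg (g := c).
  by have := H 0%N; rewrite coefD coefMX coefC /= add0r.
exists (g *: a + b).
rewrite derivMXaddC hornerMXaddC hornerD hornerMX gradD gradM ea eb.
rewrite mulmxDl -scalemxAl.
move: (a *m _) (b *m _) (grad g) q.[g] q^`().[g] => A B G x y.
by apply/rowP => i; rewrite !mxE; ring.
Qed.

Hypothesis char0 : [pchar K] =i pred0.

Lemma mpoly_natr_eq0 k : ((k%:R : {mpoly K[n]}) == 0) = (k == 0%N).
Proof.
by rewrite -(rmorph_nat (@mpolyC n K)) mpolyC_eq0; move/pcharf0P: char0 => ->.
Qed.

(** While the derivative of [q] vanishes at [g], it replaces [q]: it is nonzero in characteristic 0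
    and has smaller degree. Once it does not vanish, differentiating [q.[g] = 0] gives the
    relation. *)
Lemma algebraic_rationally_dependent g :
  algebraic_over f g -> rationally_dependent g.
Proof.
move=> [q [q0 [cq qg]]].
move: {2}(size q).+1 (ltnSn (size q)) => N.
elim: N q q0 cq qg => // N IH q q0 cq qg sq.
have [dg|dg] := eqVneq q^`().[g] 0; last first.
  have [a ea] := grad_horner g cq; exists q^`().[g], (- a); split=> //.
  rewrite mulNmx; apply/eqP; rewrite -addr_eq0 addrC -ea qg.
  by apply/eqP/rowP => i; rewrite !mxE mderiv0.
have sq1 : (1 < size q)%N.
  rewrite ltnNge; apply: contra q0 => s1; move: qg.
  by rewrite (size1_polyC s1) hornerC => ->.
apply: (IH q^`()) => //.
- have : lead_coef q *+ (size q).-1 != 0.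
    rewrite -mulr_natr mulf_neq0 ?lead_coef_eq0 // mpoly_natr_eq0.
    by move: sq1; case: (size q) => [|[]].
  apply: contra_neq => dq; have := congr1 (fun r : {poly _} => r`_(size q).-2) dq.
  by rewrite coef_deriv coef0 lead_coefE; move: sq1; case: (size q) => [|[]].
- by move=> i; rewrite coef_deriv; apply: in_subalgMn.
by apply: leq_trans (lt_size_deriv q0) _.
Qed.

(** Full row rank at [xi] gives a constant right inverse there. Its product with the polynomial
    Jacobian has determinant 1 at [xi], and the adjugate turns that product into the scalar [mu]. *)
Lemma right_inverse_off_locus xi : ~ jacobian_locus f xi ->
  exists (B : 'M[{mpoly K[n]}]_(n, s)) (mu : {mpoly K[n]}),
    jacobian *m B = mu%:M /\ mu.@[xi] != 0.
Proof.
move=> nJ; set M := map_mx (meval xi) jacobian.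
have /row_freeP [B MB] : row_free M.
  rewrite -kermx_eq0; apply: contraT => /rowV0Pn [v /sub_kermxP vM v0].
  case: nJ; exists (fun j => v 0 j); split.
    by move: v0 => /rV0Pn.
  move=> i; have /rowP/(_ i) := vM; rewrite !mxE => e; rewrite -[RHS]e.
  by apply: eq_bigr => j _; rewrite !mxE.
pose B' : 'M[{mpoly K[n]}]_(n, s) := map_mx (@mpolyC n K) B.
exists (B' *m \adj (jacobian *m B')), (\det (jacobian *m B')).
split; first by rewrite mulmxA mul_mx_adj.
rewrite -det_map_mx map_mxM -/M.
have -> : map_mx (meval xi) B' = B by apply/matrixP => i j; rewrite !mxE mevalC.
by rewrite MB det1 oner_eq0.
Qed.

(* Equality of mixed partials makes [H^T M] symmetric, where [M] is the Jacobian
   and the rows of [H] are the gradients of the [h_j]; a right inverse of [M]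
   then expresses [H] through [M]. *)
Lemma coefficients_dependent xi g (h : 'rV_s) : ~ jacobian_locus f xi ->
  grad g = h *m jacobian -> forall j, rationally_dependent (h 0 j).
Proof.
move=> /right_inverse_off_locus [B [mu [MB mux]]] eg j.
pose H : 'M[{mpoly K[n]}]_(s, n) := \matrix_(j, i) mderiv i (h 0 j).
have sym : H^T *m jacobian = jacobian^T *m H.
  rewrite -[RHS]trmxK trmx_mul trmxK; apply/matrixP => a b.
  have E c : mderiv c g = \sum_k h 0 k * mderiv c (f k).
    have /rowP/(_ c) := eg; rewrite !mxE => ->.
    by apply: eq_bigr => k _; rewrite mxE.
  (* The second sum is symmetric in [c] and [d], and so is the left side, hence so is the first
     term. *)
  have E2 c d : mderiv d (mderiv c g) = (H^T *m jacobian) d c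
      + \sum_k h 0 k * mderiv d (mderiv c (f k)).
    rewrite E raddf_sum mxE -big_split; apply: eq_bigr => k _ /=.
    by rewrite mderivM !mxE.
  rewrite [RHS]mxE; apply: (addIr (\sum_k h 0 k * mderiv a (mderiv b (f k)))).
  rewrite -E2 mderiv_comm E2; congr (_ + _).
  by apply: eq_bigr => k _; rewrite mderiv_comm.
(* Multiplying [sym] by [B] and transposing gives [mu *: H = (H *m B)^T *m jacobian]. *)
exists mu, (row j (H *m B)^T); split.
  by apply: contraNneq mux => ->; rewrite meval0.
have -> : grad (h 0 j) = row j H by apply/rowP => i; rewrite !mxE.
rewrite -row_mul -[_^T *m _]trmxK trmx_mul trmxK mulmxA -sym -mulmxA MB.
by rewrite mul_mx_scalar linearZ /= trmxK linearZ.
Qed.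
End Jacobian.

(** * The weighted grading *)

Lemma regular_coefficients (K : closedFieldType) (n s : nat)
    (f : 'I_s -> {mpoly K[n]}) g : codim_ge 2 (jacobian_locus f) ->
  rationally_dependent f g -> exists h : 'rV_s, grad g = h *m jacobian f.
Proof.
move=> cod [D [a [/is_ufd_mpoly pD]]].
elim: pD a => [u uu|p {}D pp _ IH] a e.
  by exists (u^-1 *: a); rewrite -scalemxAl -e scalerA mulVr // scale1r.
have [xi pxi nJ] := codim2_prime cod pp.
have [B [mu [MB muxi]]] := right_inverse_off_locus nJ.
have [_ _ pprime] := pp; have p0 : p != 0 by case: pp.
(* Applying [B] to [e] shows that [p] divides [mu * a 0 j]; as [mu] is nonzero at the zero [xi] of
   [p], it must divide [a 0 j]. *)
have da j : exists b, a 0 j = p * b.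
  have [|[k ek]|//] := pprime mu (a 0 j).
    exists (D * (grad g *m B) 0 j).
    have /rowP/(_ j) := congr1 (mulmx^~ B) e.
    by rewrite /= -scalemxAl -mulmxA MB mul_mx_scalar !mxE mulrA => ->.
  by case/eqP: muxi; rewrite ek mevalM pxi mul0r.
have {da} [b eb] := fin_all_exists da.
apply: (IH (\row_j b j)); apply/rowP => i; apply: (mulfI p0).
have /rowP/(_ i) := e; rewrite !mxE mulrA => ->; rewrite mulr_sumr.
by apply: eq_bigr => j _; rewrite [in RHS]mxE mulrA -eb.
Qed.

Section Grading.
Variables (K : fieldType) (n : nat) (w : 'I_n -> nat).
Implicit Types (p q : {mpoly K[n]}) (m : 'X_{1..n}) (d e : nat) (k : 'I_n).

(** Homogeneity with explicit degree; zero is isobaric of every degree. *)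
Definition isobaric d p := forall m, m \in msupp p -> wdeg w m = d.

Lemma isobaricP d p : isobaric d p <-> forall m, wdeg w m != d -> p@_m = 0.
Proof.
split=> H m; first by move=> nd; apply/eqP; rewrite mcoeff_eq0; apply: contra nd => /H ->.
by rewrite mcoeff_msupp; apply: contraNeq => /H ->.
Qed.

Lemma wdegD m1 m2 : wdeg w (m1 + m2) = (wdeg w m1 + wdeg w m2)%N.
Proof.
by rewrite /wdeg -big_split; apply: eq_bigr => i _; rewrite mnmDE mulnDr.
Qed.

Lemma isobaricM d e p q : isobaric d p -> isobaric e q -> isobaric (d + e) (p * q).
Proof.
move=> hp hq m /msuppM_le /allpairsP [[m1 m2] /= [/hp h1 /hq h2 ->]].
by rewrite wdegD h1 h2.
Qed.

Lemma isobaricX m : isobaric (wdeg w m) ('X_[m]).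
Proof. by move=> m'; rewrite msuppX inE => /eqP ->. Qed.

Definition wcomp e p : {mpoly K[n]} :=
  \sum_(m <- msupp p | wdeg w m == e) p@_m *: 'X_[m].

Lemma mcoeff_wcomp e p m :
  (wcomp e p)@_m = if wdeg w m == e then p@_m else 0.
Proof.
rewrite raddf_sum /=; have [mp|mp] := boolP (m \in msupp p); last first.
  rewrite (memN_msupp_eq0 mp) if_same big_seq_cond big1 // => m' /andP [m'p _].
  rewrite mcoeffZ mcoeffX; case: eqP => [e'|]; last by rewrite mulr0.
  by rewrite -e' m'p in mp.
rewrite big_mkcond (bigD1_seq m) ?msupp_uniq //= big1 => [|m' nm].
  by rewrite addr0 mcoeffZ mcoeffX eqxx mulr1.
by case: ifP => // _; rewrite mcoeffZ mcoeffX (negbTE nm) mulr0.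
Qed.

Lemma wcompD e p q : wcomp e (p + q) = wcomp e p + wcomp e q.
Proof.
by apply/mpolyP => m; rewrite mcoeffD !mcoeff_wcomp mcoeffD; case: eqP; rewrite ?addr0.
Qed.

Lemma wcompZ e c p : wcomp e (c *: p) = c *: wcomp e p.
Proof.
by apply/mpolyP => m; rewrite mcoeffZ !mcoeff_wcomp mcoeffZ; case: eqP; rewrite ?mulr0.
Qed.

Lemma wcomp0 e : wcomp e 0 = 0.
Proof. by rewrite -[X in wcomp e X](scale0r 0) wcompZ scale0r. Qed.

Lemma wcomp_sum e (I : Type) (r : seq I) (F : I -> {mpoly K[n]}) :
  wcomp e (\sum_(i <- r) F i) = \sum_(i <- r) wcomp e (F i).
Proof. by apply: (big_morph (wcomp e)); [exact: wcompD | exact: wcomp0]. Qed.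

Lemma wcomp_isobaric e d p : isobaric d p -> wcomp e p = if d == e then p else 0.
Proof.
move=> /isobaricP hp; apply/mpolyP => m; rewrite mcoeff_wcomp.
have [<-|nd] := eqVneq (wdeg w m) d; first by case: eqP; rewrite ?mcoeff0.
by rewrite hp // if_same; case: eqP => _; rewrite ?mcoeff0 ?hp.
Qed.

Lemma isobaric_wcomp e p : isobaric e (wcomp e p).
Proof. by apply/isobaricP => m /negbTE nm; rewrite mcoeff_wcomp nm. Qed.

(** Multiplication by [q] raises weights by [d]. The test [d <= e] guards against truncated
    subtraction, which would pick the weight-0 part of [p]. *)
Lemma wcompM e d p q : isobaric d q ->
  wcomp e (p * q) = (if (d <= e)%N then wcomp (e - d) p else 0) * q.
Proof.
move=> hq; elim/mpolyind: p => [|c m p _ _ IH].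
  by rewrite mul0r !wcomp0 if_same mul0r.
rewrite mulrDl wcompD IH -scalerAl wcompZ.
rewrite (wcomp_isobaric e (isobaricM (@isobaricX m) hq)).
case: leqP => de; last first.
  by rewrite gtn_eqF ?scaler0 ?add0r //; lia.
rewrite wcompD wcompZ (wcomp_isobaric _ (@isobaricX m)) mulrDl -scalerAl.
congr (_ *: _ + _); have -> : (wdeg w m + d == e)%N = (wdeg w m == e - d)%N by lia.
by case: eqP; rewrite ?mul0r.
Qed.

Lemma sum_wcomp p : exists N, p = \sum_(e < N) wcomp e p.
Proof.
exists (\max_(m <- msupp p) wdeg w m).+1; apply/mpolyP => m.
rewrite raddf_sum /=; have [mp|mp] := boolP (m \in msupp p); last first.
  rewrite (memN_msupp_eq0 mp) big1 // => e _.
  by rewrite mcoeff_wcomp (memN_msupp_eq0 mp) if_same.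
have lt : (wdeg w m < (\max_(m <- msupp p) wdeg w m).+1)%N.
  by rewrite ltnS; apply: leq_bigmax_seq.
rewrite (bigD1 (Ordinal lt)) //= big1 ?addr0 ?mcoeff_wcomp ?eqxx // => e ne.
by rewrite mcoeff_wcomp; case: eqP => // E; case/eqP: ne; apply: val_inj; rewrite /= E.
Qed.

(* Unlike [mderiv k], this operator preserves weights. *)
Definition xderiv k p := 'X_k * mderiv k p.

Lemma mcoeff_xderiv k p m : (xderiv k p)@_m = p@_m *+ m k.
Proof.
rewrite /xderiv; elim/mpolyind: p => [|c m' p _ _ IH].
  by rewrite mderiv0 mulr0 mcoeff0 mul0rn.
rewrite mderivD mulrDr !mcoeffD IH mulrnDl; congr (_ + _).
rewrite mderivZ mderivX -!scalerAr !mcoeffZ -mpolyXD mcoeffX.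
have [mk|mk] := eqVneq (m' k) 0%N.
  rewrite mk mul0r mulr0; case: eqP => [<-|_]; first by rewrite mk.
  by rewrite mulr0 mul0rn.
rewrite addmC submK; last by rewrite lep1mP.
rewrite mcoeffX; case: eqP => [->|_]; last by rewrite !mulr0 mul0rn.
by rewrite !mulr1 mulr_natr.
Qed.

Lemma wcomp_xderiv e k p : wcomp e (xderiv k p) = xderiv k (wcomp e p).
Proof.
apply/mpolyP => m; rewrite mcoeff_wcomp !mcoeff_xderiv mcoeff_wcomp.
by case: eqP; rewrite ?mul0rn.
Qed.

Lemma isobaric_xderiv d k p : isobaric d p -> isobaric d (xderiv k p).
Proof.
move=> /isobaricP hp; apply/isobaricP => m /hp.
by rewrite mcoeff_xderiv => ->; rewrite mul0rn.
Qed.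

(** Euler's formula: on a monomial [m] the left side acts by the scalar [wdeg w m]. *)
Lemma euler d p : isobaric d p -> \sum_k xderiv k p *+ w k = p *+ d.
Proof.
move=> /isobaricP hp; apply/mpolyP => m; rewrite raddf_sum mcoeffMn /=.
under eq_bigr => k _ do rewrite mcoeffMn mcoeff_xderiv -mulrnA mulnC.
rewrite sumrMnr -/(wdeg w m); have [->//|/hp ->] := eqVneq (wdeg w m) d.
by rewrite !mul0rn.
Qed.

Lemma isobaric0_const p : (forall i, (0 < w i)%N) -> isobaric 0 p -> p = (p@_0%MM)%:MP.
Proof.
move=> w0 /isobaricP hp; apply/mpolyP => m; rewrite mcoeffC.
have [->|nm] := eqVneq 0%MM m; first by rewrite mulr1.
rewrite mulr0; apply: hp; apply: contra_neq nm => /eqP.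
rewrite sum_nat_eq0 => /forallP H; apply/mnmP => i; rewrite mnm0E.
by have := H i; rewrite muln_eq0 eqn0Ngt w0 /= => /eqP.
Qed.

(** Multiplied by ['X_k], the relation in coordinate [k] involves only the weight-preserving
    [xderiv k]; one takes components of weight [e] and cancels ['X_k]. *)
Lemma grad_wcomp (s : nat) (f : 'I_s -> {mpoly K[n]}) (d : 'I_s -> nat) e g
    (h : 'rV_s) : (forall j, isobaric (d j) (f j)) -> grad g = h *m jacobian f ->
  grad (wcomp e g) =
    (\row_j if (d j <= e)%N then wcomp (e - d j) (h 0 j) else 0) *m jacobian f.
Proof.
move=> hf eg; apply/rowP => k; apply: (@mulfI _ ('X_k : {mpoly K[n]})).
  by rewrite -msize_poly_eq0 msizeX.
have /rowP/(_ k) := eg; rewrite !mxE => ek.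
rewrite -/(xderiv k _) -wcomp_xderiv /xderiv ek !mulr_sumr wcomp_sum.
apply: eq_bigr => j _; rewrite !mxE !(mulrCA 'X_k).
by rewrite -!/(xderiv _ _) (wcompM _ _ (isobaric_xderiv (hf j))).
Qed.
End Grading.

Theorem theorem1p1 (K : closedFieldType) (n : nat) (w : 'I_n -> nat)
    (s : nat) (f : 'I_s -> {mpoly K[n]}) :
  [pchar K] =i pred0 ->
  (forall i, (0 < w i)%N) ->
  (forall j, whomog w (f j)) ->
  codim_ge 2 (jacobian_locus f) ->
  forall g : {mpoly K[n]}, algebraic_over f g -> in_subalg f g.
Proof.
move=> char0 w0 hf cod g alg.
have {hf} [d hf] : exists d, forall j, isobaric w (d j) (f j) by exact: fin_all_exists hf.
have [xi nJ] := codim2_nonempty_complement cod.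
have [B [mu [MB muxi]]] := right_inverse_off_locus nJ.
(* If [d j = 0], then [f j] is constant, row [j] of the Jacobian vanishes, and so does [mu], a
   diagonal entry of its product with [B]. *)
have d0 j : (0 < d j)%N.
  rewrite lt0n; apply: contra_neqN muxi => /eqP dj.
  have fC : f j = ((f j)@_0%MM)%:MP by apply: (isobaric0_const w0); rewrite -dj.
  have := congr1 (fun A : 'M__ => A j j) MB; rewrite !mxE eqxx mulr1n => <-.
  rewrite big1 ?meval0 // => i _.
  by rewrite mxE fC mderivC mul0r.
(* Strong induction on the weight, for rational dependence rather than algebraicity, since the
   former passes to the coefficients. *)
have key e p : isobaric w e p -> rationally_dependent f p -> in_subalg f p.
  move: p; elim/ltn_ind: e => e IH p hp rp.
  have [e0|ne0] := eqVneq e 0%N.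
    rewrite e0 in hp; rewrite (isobaric0_const w0 hp); exact: in_subalgC.
  have [h eh] := regular_coefficients cod rp.
  (* Only the part of weight [e - d j] of each [h 0 j] is kept. *)
  have := grad_wcomp e hf eh; rewrite (wcomp_isobaric _ hp) eqxx.
  set h' := \row_j _ => eh'.
  (* Symmetry of second derivatives makes [h' 0 j] rationally dependent too; it is zero or of weight
     below [e], because [d j > 0]. *)
  have sub j : in_subalg f (h' 0 j).
    have := coefficients_dependent nJ eh' j; rewrite mxE.
    case: leqP => [de|_ _]; last exact: in_subalg0.
    apply: (IH (e - d j)%N); last exact: isobaric_wcomp.
    by rewrite ltn_subrL d0 lt0n.
  (* Euler's formula for [p], the relation [eh'], then Euler's formula for each [f j]. *)
  have E : p *+ e = \sum_j h' 0 j * (f j *+ d j).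
    rewrite -(euler hp) (eq_bigr (fun k => \sum_j h' 0 j * (xderiv k (f j) *+ w k))).
      by rewrite exchange_big; apply: eq_bigr => j _; rewrite -mulr_sumr (euler (hf j)).
    move=> k _; have /rowP/(_ k) := eh'; rewrite /xderiv [LHS]mxE [RHS]mxE => ->.
    rewrite mulr_sumr -sumrMnl; apply: eq_bigr => j _.
    by rewrite [jacobian _ _ _]mxE mulrCA mulrnAr.
  have -> : p = (e%:R)^-1 *: (p *+ e).
    rewrite -scaler_nat scalerA mulVf ?scale1r //.
    by move/pcharf0P: char0 => ->.
  apply: in_subalgZ; rewrite E; apply: in_subalg_sum => j _.
  by apply: in_subalgM => //; apply: in_subalgMn; apply: in_subalg_gen.
have [h eh] := regular_coefficients cod (algebraic_rationally_dependent char0 alg).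
(* [g] need not be homogeneous: its relation with polynomial coefficients splits by weight, giving
   each component one with denominator 1. *)
have [N ->] := sum_wcomp w g; apply: in_subalg_sum => e _.
apply: (key e); first exact: isobaric_wcomp.
exists 1, (\row_j if (d j <= e)%N then wcomp w (e - d j) (h 0 j) else 0).
by rewrite oner_eq0 scale1r (grad_wcomp e hf eh).
Qed.
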